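(* Let $n,k\ge1$. A square Hermitian orthogonal design $\mathcal{O}_x$ of size $[n,n,2k]$ exists if and only if $2^{k-1}\mid n$. Moreover, for any such $\mathcal{O}_x$ there exist $U,V\in U_n(\mathbb{C})$ and unique nonnegative integers $n_1,n_2$ with $n_1+n_2=n/2^{k-1}$ such that $$\mathcal{O}_x=U\,\mathrm{diag}(\underbrace{\mathcal{H}_{2k},\ldots,\mathcal{H}_{2k}}_{n_1},\underbrace{\mathcal{H}^-_{2k},\ldots,\mathcal{H}^-_{2k}}_{n_2})\,V=U\big((I_{n_1}\otimes\mathcal{H}_{2k})\oplus(I_{n_2}\otimes\mathcal{H}^-_{2k})\big)V.$$
   Context: Let $x_1,x_2,\ldots$ be formal real indeterminates. A Hermitian orthogonal design (HOD) of size $[p,n,m]$ is a $p\times n$ matrix $\mathcal{O}_x$ whose entries are complex linear combinations of $x_1,\ldots,x_m$ such that $\mathcal{O}_x^H\mathcal{O}_x=(x_1^2+\cdots+x_m^2)I_n$; it is square if $p=n$. Define $\mathcal{H}_2=(x_1+x_2\sqrt{-1})$ and for $k>1$ the $2^{k-1}\times2^{k-1}$ matrix $$\mathcal{H}_{2k}=\begin{pmatrix}\mathcal{H}_{2k-2} & (x_{2k-1}+x_{2k}\sqrt{-1})I_{2^{k-2}}\\ -(x_{2k-1}-x_{2k}\sqrt{-1})I_{2^{k-2}} & \mathcal{H}_{2k-2}^H\end{pmatrix},$$ where $^H$ is conjugate transpose with the $x_i$ treated as real. Let $\mathcal{H}_{2k}^-$ be obtained from $\mathcal{H}_{2k}$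 by replacing $x_{2k}$ with $-x_{2k}$. $U_n(\mathbb{C})$ is the group of $n\times n$ unitary matrices. *)

(* Defs.v *)
From HB Require Import structures.
From mathcomp Require Import all_boot all_order all_algebra.
From mathcomp Require Import complex mxtens.
From mathcomp Require Import reals.
Set Implicit Arguments. Unset Strict Implicit. Unset Printing Implicit Defensive.
Import Order.TTheory GRing.Theory Num.Theory.
Local Open Scope ring_scope.
Local Open Scope complex_scope.

Definition mxH (R : rcfType) m n (A : 'M[R[i]]_(m, n)) : 'M[R[i]]_(n, m) :=
  (map_mx (@conjc R) A)^T.

Definition unitary (R : rcfType) n (U : 'M[R[i]]_n) : Prop :=
  mxH U *m U = 1%:M /\ U *m mxH U = 1%:M.

(* A p x n matrix whose entries are complex linear combinations of the real
   indeterminates x_1, ..., x_m is given by its coefficient matrices A_1..A_m: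
   O_x = \sum_i x_i A_i.  Indeterminates are indexed from 0: x_1 = x 0. *)
Definition design (R : rcfType) p n m (A : 'I_m -> 'M[R[i]]_(p, n))
  (x : nat -> R) : 'M[R[i]]_(p, n) :=
  \sum_(i < m) (x i)%:C *: A i.

(* Hermitian orthogonal design of size [p, n, m]: O_x^H O_x = (x_1^2+...+x_m^2) I_n
   for all real values of the indeterminates (equivalent to the formal identity). *)
Definition is_HOD (R : rcfType) p n m (A : 'I_m -> 'M[R[i]]_(p, n)) : Prop :=
  forall x : nat -> R,
    mxH (design A x) *m design A x = (\sum_(i < m) x i ^+ 2)%:C%:M.

Lemma expn2S_eq j : (2 ^ j + 2 ^ j = 2 ^ j.+1)%N.
Proof. by rewrite expnS mul2n addnn. Qed.

(* Hrec j x = H_{2(j+1)} (a 2^j x 2^j matrix) evaluated at x. *)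
Fixpoint Hrec (R : rcfType) (j : nat) (x : nat -> R) : 'M[R[i]]_(2 ^ j) :=
  match j with
  | 0 => castmx (esym (expn0 2), esym (expn0 2))
           ((x 0%N +i* x 1%N)%:M : 'M[R[i]]_1)
  | j'.+1 =>
      castmx (expn2S_eq j', expn2S_eq j')
        (block_mx (Hrec j' x) ((x j'.*2.+2 +i* x j'.*2.+3)%:M)
                  (- (x j'.*2.+2 -i* x j'.*2.+3)%:M) (mxH (Hrec j' x)))
  end.

Definition Hmat (R : rcfType) (k : nat) (x : nat -> R) : 'M[R[i]]_(2 ^ k.-1) :=
  Hrec k.-1 x.

Definition Hmat_minus (R : rcfType) (k : nat) (x : nat -> R)
  : 'M[R[i]]_(2 ^ k.-1) :=
  Hrec k.-1 (fun i => if i == (k.*2).-1 then - x i else x i).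

Definition HOD_decomp (R : rcfType) n k (A : 'I_(k.*2) -> 'M[R[i]]_n)
  (n1 n2 : nat) : Prop :=
  exists e : (n1 * 2 ^ k.-1 + n2 * 2 ^ k.-1 = n)%N,
  exists U V : 'M[R[i]]_n, unitary U /\ unitary V /\
    forall x : nat -> R,
      design A x =
      U *m castmx (e, e)
        (block_mx ((1%:M : 'M_n1) *t Hmat k x) 0 0
                  ((1%:M : 'M_n2) *t Hmat_minus k x)) *m V.

(* Main.v *)
(* Normalising by A_0 turns a design into 2k - 1 anticommuting skew-Hermitian
   unitaries B_1, ..., B_{2k-1} (a Clifford family).  Since B_1 and the products
   B_{2l} B_{2l+1} commute and square to -1, they have a common eigenvector, and the B's
   allow one to choose its eigenvalues: all equal to i, or all but the last one.
   Such a unit vector generates a copy of H_{2k} (resp. H_{2k}^-) through the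
   recursion W |-> [W, - B_{2l} W], which mirrors that of H_{2k}.  The complement
   of such copies is invariant, so they can be split off one by one.  The trace of
   B_1 B_2 ... B_{2k-1} is i^k 2^{k-1} (n_1 - n_2), whence uniqueness. *)
Require Import Defs.
From HB Require Import structures.
From mathcomp Require Import all_boot all_order all_algebra.
From mathcomp Require Import complex mxtens.
From mathcomp Require Import reals ring zify.
Set Implicit Arguments. Unset Strict Implicit. Unset Printing Implicit Defensive.
Import Order.TTheory GRing.Theory Num.Theory.
Local Open Scope ring_scope.

Ltac complex_ring :=
  apply/eqP; rewrite eq_complex /=; apply/andP; split; apply/eqP; ring.

(** * Conjugate transposes and norms *)

Section Adjoint.
Variable R : rcfType.
Local Notation C := (R[i]).

Lemma mxHM m n p (A : 'M[C]_(m, n)) (B : 'M[C]_(n, p)) :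
  mxH (A *m B) = mxH B *m mxH A.
Proof. by rewrite /mxH map_mxM trmx_mul. Qed.

Lemma mxHD m n (A B : 'M[C]_(m, n)) : mxH (A + B) = mxH A + mxH B.
Proof. by rewrite /mxH map_mxD linearD. Qed.

Lemma mxHN m n (A : 'M[C]_(m, n)) : mxH (- A) = - mxH A.
Proof. by rewrite /mxH map_mxN linearN. Qed.

Lemma mxHZ m n a (A : 'M[C]_(m, n)) : mxH (a *: A) = conjc a *: mxH A.
Proof. by rewrite /mxH map_mxZ linearZ. Qed.

Lemma mxHK m n (A : 'M[C]_(m, n)) : mxH (mxH A) = A.
Proof. by apply/matrixP=> i j; rewrite !mxE conjcK. Qed.

Lemma mxH_scalar n a : mxH (a%:M : 'M[C]_n) = (conjc a)%:M.
Proof. by rewrite /mxH map_scalar_mx tr_scalar_mx. Qed.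

Lemma mxH1 n : mxH (1%:M : 'M[C]_n) = 1%:M.
Proof. by rewrite mxH_scalar conjc1. Qed.

Lemma mxH0 m n : mxH (0 : 'M[C]_(m, n)) = 0.
Proof. by rewrite /mxH map_mx0 trmx0. Qed.

Lemma mxH_row m n p (A : 'M[C]_(m, n)) (B : 'M[C]_(m, p)) :
  mxH (row_mx A B) = col_mx (mxH A) (mxH B).
Proof. by rewrite /mxH map_row_mx tr_row_mx. Qed.

Lemma mxH_block m1 m2 n1 n2 (A : 'M[C]_(m1, n1)) (B : 'M[C]_(m1, n2))
    (A' : 'M[C]_(m2, n1)) (B' : 'M[C]_(m2, n2)) :
  mxH (block_mx A B A' B') = block_mx (mxH A) (mxH A') (mxH B) (mxH B').
Proof. by rewrite /mxH map_block_mx tr_block_mx. Qed.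

Lemma mxH_cast m n m' n' (e : m = m') (e' : n = n') (A : 'M[C]_(m, n)) :
  mxH (castmx (e, e') A) = castmx (e', e) (mxH A).
Proof. by case: m' / e; case: n' / e'. Qed.

Lemma mxH_tens m n p q (A : 'M[C]_(m, n)) (B : 'M[C]_(p, q)) :
  mxH (A *t B) = mxH A *t mxH B.
Proof. by rewrite /mxH map_mxT trmx_tens. Qed.

Lemma castmx_isometry n m m' (e : m = m') (P : 'M[C]_(n, m)) :
  mxH P *m P = 1%:M ->
  mxH (castmx (erefl n, e) P) *m castmx (erefl n, e) P = 1%:M.
Proof. by case: m' / e. Qed.

(** The squared norm is a positive real, hence the square of a real; in this form a vector can be
    normalised by a real scalar. *)
Lemma mxH_mulmx_cV n (v : 'cV[C]_n) :
  v != 0 -> exists2 r : R, r != 0 & mxH v *m v = (r ^+ 2)%:C%C%:M.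
Proof.
move=> v0; pose s := \sum_i (complex.Re (v i 0) ^+ 2 + complex.Im (v i 0) ^+ 2).
have s_ge0 : 0 <= s by apply: sumr_ge0 => i _; rewrite addr_ge0 ?sqr_ge0.
have sE : mxH v *m v = s%:C%C%:M.
  apply/matrixP=> a b; rewrite !ord1 !mxE eqxx mulr1n /s raddf_sum /=.
  apply: eq_bigr => i _; rewrite !mxE; case: (v i 0) => x y /=.
  by complex_ring.
exists (Num.sqrt s); last by rewrite sqr_sqrtr.
rewrite sqrtr_eq0 -ltNge lt_def s_ge0 andbT; apply: contra v0 => /eqP s0.
apply/eqP/matrixP=> i b; rewrite !ord1 mxE.
have /eqP := s0; rewrite psumr_eq0 => [/allP /(_ i)|k _]; last first.
  by rewrite addr_ge0 ?sqr_ge0.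
rewrite mem_index_enum => /(_ isT) /=.
rewrite paddr_eq0 ?sqr_ge0 // !sqrf_eq0; case: (v i 0) => x y /= /andP[/eqP-> /eqP->].
by [].
Qed.

End Adjoint.

(** * The matrices [Hrec] as real-linear functions of the indeterminates *)

Section Hrec.
Variable R : rcfType.
Local Notation C := (R[i]).
Implicit Types x y : nat -> R.

Definition conjx x i := if i == 0%N then x i else - x i.

(** All coefficients but the first are skew-Hermitian. The adjoint in the lower right block thus
    becomes another value of [Hrec], open to induction. *)
Lemma Hrec_conjx j x : Hrec j (conjx x) = mxH (Hrec j x).
Proof.
elim: j => [|j IH] /=; first by rewrite mxH_cast mxH_scalar.
rewrite mxH_cast mxH_block IH mxHK mxHN !mxH_scalar; congr (castmx _ (block_mx _ _ _ _)).
- by rewrite /conjx /= -raddfN; congr (_%:M); complex_ring.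
- by rewrite /conjx /= -raddfN; congr (_%:M); complex_ring.
Qed.

Lemma eq_Hrec j x y : (forall i, (i < j.*2.+2)%N -> x i = y i) -> Hrec j x = Hrec j y.
Proof.
elim: j => [|j IH] xy /=; first by rewrite !xy.
have -> : Hrec j x = Hrec j y by apply: IH => i li; apply: xy; rewrite doubleS; do 2 apply: ltnW.
by rewrite !xy // doubleS.
Qed.

Lemma castmxD m n m' n' (e : (m = m') * (n = n')) (A B : 'M[C]_(m, n)) :
  castmx e (A + B) = castmx e A + castmx e B.
Proof. by case: e => e e'; case: m' / e; case: n' / e'. Qed.

Lemma castmxZ m n m' n' (e : (m = m') * (n = n')) a (A : 'M[C]_(m, n)) :
  castmx e (a *: A) = a *: castmx e A.
Proof. by case: e => e e'; case: m' / e; case: n' / e'. Qed.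

Lemma castmx_scalar n n' (e : n = n') (a : C) : castmx (e, e) a%:M = a%:M.
Proof. by case: n' / e. Qed.

Lemma castmx_mul2 n n' (e : n = n') (A B : 'M[C]_n) :
  castmx (e, e) A *m castmx (e, e) B = castmx (e, e) (A *m B).
Proof. by case: n' / e. Qed.

(** The adjoint in the lower right block is only conjugate-linear, so the scalar is taken real. *)
Lemma Hrec_linear j (a : R) x y :
  Hrec j (fun i => a * x i + y i) = a%:C%C *: Hrec j x + Hrec j y.
Proof.
elim: j => [|j IH] /=.
  rewrite -castmxZ -castmxD scale_scalar_mx -raddfD; congr (castmx _ _%:M).
  by complex_ring.
rewrite -castmxZ -castmxD scale_block_mx add_block_mx IH.
rewrite mxHD mxHZ conjc_real scalerN !scale_scalar_mx -!raddfN -!raddfD.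
by congr (castmx _ (block_mx _ _%:M _%:M _)); complex_ring.
Qed.

Definition unitx (l : nat) : nat -> R := fun i => (i == l)%:R.

Lemma Hrec0 j : Hrec j (fun=> 0 : R) = 0.
Proof.
have := Hrec_linear j 1 (fun=> 0) (fun=> 0).
rewrite scale1r (@eq_Hrec _ _ (fun=> 0)) => [/eqP|i _]; last by rewrite mulr0 addr0.
by rewrite -subr_eq0 opprD addrA subrr add0r oppr_eq0 => /eqP.
Qed.

Lemma Hrec_sum j x : Hrec j x = \sum_(i < j.*2.+2) (x i)%:C%C *: Hrec j (unitx i).
Proof.
(* Indeterminates from [N] on are set to zero; the induction releases one at a time. *)
have aux N : (N <= j.*2.+2)%N ->
    Hrec j (fun i => if (i < N)%N then x i else 0)
      = \sum_(i < N) (x i)%:C%C *: Hrec j (unitx i).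
  elim: N => [|N IH] lN; first by rewrite big_ord0 -(Hrec0 j); apply: eq_Hrec.
  rewrite big_ord_recr /= -IH 1?ltnW // addrC -Hrec_linear; apply: eq_Hrec => i _.
  rewrite /unitx ltnS leq_eqVlt; case: eqP => [->|_] /=; first by rewrite ltnn mulr1 addr0.
  by rewrite mulr0 add0r.
by rewrite -aux //; apply: eq_Hrec => i ->.
Qed.

Lemma Hrec_unitx0 j : Hrec j (unitx 0) = 1%:M.
Proof.
elim: j => [|j IH] /=; first by rewrite castmx_scalar; congr (_%:M).
rewrite IH mxH1 /unitx /=.
have -> : (0%R +i* 0%R)%C = 0 :> C by [].
have -> : (0%R -i* 0%R)%C = 0 :> C by complex_ring.
by rewrite !raddf0 -scalar_mx_block castmx_scalar.
Qed.

Lemma Hrec_HOD j x :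
  mxH (Hrec j x) *m Hrec j x = (\sum_(i < j.*2.+2) x i ^+ 2)%:C%C%:M.
Proof.
elim: j x => [|j IH] x.
  rewrite /= mxH_cast castmx_mul2 mxH_scalar -scalar_mxM castmx_scalar; congr (_%:M).
  by rewrite !big_ord_recl big_ord0 /= /bump /=; complex_ring.
rewrite doubleS 2!big_ord_recr /=.
set s := \sum_(i < _) _.
have Hs : mxH (Hrec j x) *m Hrec j x = s%:C%C%:M by apply: IH.
(* The product in the other order is the induction hypothesis at [conjx x], which has the same sum
   of squares. *)
have Hs' : Hrec j x *m mxH (Hrec j x) = s%:C%C%:M.
  rewrite -{1}[Hrec j x]mxHK -Hrec_conjx IH; congr (_%:C%C%:M).
  by apply: eq_bigr => i _; rewrite /conjx; case: eqP; rewrite ?sqrrN.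
rewrite mxH_cast castmx_mul2 mxH_block mulmx_block mxHK mxHN !mxH_scalar Hs Hs'.
set a := x _; set b := x _.
rewrite !mulNmx !mulmxN opprK -!scalar_mxM !mul_scalar_mx !mul_mx_scalar.
have -> : conjc (a -i* b)%C = (a +i* b)%C by rewrite /= opprK.
rewrite !subrr /= -!raddfD [in X in block_mx _ _ _ X%:M]addrC.
rewrite [(a -i* b)%C * _]mulrC -scalar_mx_block castmx_scalar; congr (_%:M).
by complex_ring.
Qed.

End Hrec.

(** * Clifford families and the copy of [Hrec] generated by an eigenvector *)

Section Clifford.
Variables (R : rcfType) (n : nat).
Local Notation C := (R[i]).
Implicit Types (B : nat -> 'M[C]_n) (x : nat -> R) (v : 'cV[C]_n).

(* Index 0 is left free: it stands for the identity coefficient. *)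
Record clifford N B : Prop := Clifford {
  cliffordH : forall i, (0 < i < N)%N -> mxH (B i) = - B i;
  clifford_sqr : forall i, (0 < i < N)%N -> B i *m B i = - 1%:M;
  cliffordC : forall i j, (0 < i < N)%N -> (0 < j < N)%N -> i != j ->
    B i *m B j = - (B j *m B i) }.

(** The shape of a design once divided by its unitary first coefficient; [j] counts doublings, as in
    [Hrec j]. *)
Definition lin B j x : 'M[C]_n :=
  (x 0%N)%:C%C%:M + \sum_(1 <= i < j.*2.+2) (x i)%:C%C *: B i.

(** The factors carry the indices of the two indeterminates that [Hrec l.+1] adds to [Hrec l]. *)
Definition pairp B l : 'M[C]_n := B l.*2.+2 *m B l.*2.+3.

Lemma cliffordW N M B : (M <= N)%N -> clifford N B -> clifford M B.
Proof.
move=> MN [h1 h2 h3].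
have W i : (0 < i < M)%N -> (0 < i < N)%N by case/andP=> -> /leq_trans ->.
by split=> [i /W /h1|i /W /h2|i j /W Hi /W Hj /h3->].
Qed.

Lemma lin0 B x : lin B 0 x = (x 0%N)%:C%C%:M + (x 1%N)%:C%C *: B 1%N.
Proof. by rewrite /lin big_nat1. Qed.

Lemma linS B j x :
  lin B j.+1 x = lin B j x + (x j.*2.+2)%:C%C *: B j.*2.+2
                           + (x j.*2.+3)%:C%C *: B j.*2.+3.
Proof. by rewrite /lin doubleS big_nat_recr //= big_nat_recr //= !addrA. Qed.

(** [B i] commutes with the scalar term and anticommutes with each generator in [lin], so crossing
    it changes signs as [conjx] does. *)
Lemma lin_anticomm B j x i : clifford j.*2.+4 B -> (j.*2.+2 <= i < j.*2.+4)%N ->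
  lin B j x *m B i = B i *m lin B j (conjx x).
Proof.
move=> cB /andP[ji iN]; rewrite /lin /conjx eqxx mulmxDl mulmxDr scalar_mxC; congr (_ + _).
rewrite mulmx_suml mulmx_sumr; apply: eq_big_nat => l /andP[l0 lj].
rewrite -scalemxAl -scalemxAr (cliffordC cB); [|lia..].
by rewrite (negbTE (lt0n_neq0 l0)) scalerN -scaleNr raddfN.
Qed.

(** Crossing two anticommuting factors gives two signs, which cancel. *)
Lemma pairp_comm N B l i : clifford N B -> (l.*2.+3 < N)%N -> (0 < i < N)%N ->
  i != l.*2.+2 -> i != l.*2.+3 -> pairp B l *m B i = B i *m pairp B l.
Proof.
move=> cB lN iN i2 i3.
have h2 : B l.*2.+2 *m B i = - (B i *m B l.*2.+2) by apply: (cliffordC cB); lia.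
have h3 : B l.*2.+3 *m B i = - (B i *m B l.*2.+3) by apply: (cliffordC cB); lia.
by rewrite /pairp -mulmxA h3 mulmxN (mulmxA (B _) (B i)) h2 mulNmx opprK mulmxA.
Qed.

Lemma pairpC N B l l' : clifford N B -> (l.*2.+3 < N)%N -> (l'.*2.+3 < N)%N -> l != l' ->
  pairp B l *m pairp B l' = pairp B l' *m pairp B l.
Proof.
move=> cB lN l'N ll'.
have h2 : pairp B l *m B l'.*2.+2 = B l'.*2.+2 *m pairp B l by apply: (pairp_comm cB); lia.
have h3 : pairp B l *m B l'.*2.+3 = B l'.*2.+3 *m pairp B l by apply: (pairp_comm cB); lia.
by rewrite [pairp B l']/pairp mulmxA h2 -mulmxA h3 mulmxA.
Qed.

Lemma pairp_anticomm N B l : clifford N B -> (l.*2.+3 < N)%N ->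
  pairp B l *m B l.*2.+2 = - (B l.*2.+2 *m pairp B l).
Proof.
move=> cB lN.
have h : B l.*2.+3 *m B l.*2.+2 = - (B l.*2.+2 *m B l.*2.+3) by apply: (cliffordC cB); lia.
by rewrite /pairp -mulmxA h mulmxN.
Qed.

Lemma pairpH N B l : clifford N B -> (l.*2.+3 < N)%N -> mxH (pairp B l) = - pairp B l.
Proof.
move=> cB lN; rewrite /pairp mxHM !(cliffordH cB); [|lia..].
by rewrite mulNmx mulmxN opprK (cliffordC cB); [rewrite opprK|lia..].
Qed.

Lemma pairp_sqr N B l : clifford N B -> (l.*2.+3 < N)%N -> pairp B l *m pairp B l = - 1%:M.
Proof.
move=> cB lN; rewrite {2}/pairp mulmxA (pairp_anticomm cB lN) mulNmx -mulmxA; congr (- _).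
rewrite /pairp -mulmxA (clifford_sqr cB); last by lia.
by rewrite !mulmxN mulmx1 (clifford_sqr cB) ?opprK; [|lia].
Qed.

(** Up to sign, the columns are [v] hit by the products of distinct generators of even index between
    2 and 2j. The minus sign fits the lower left block of [Hrec]. *)
Fixpoint intertwiner B v j : 'M[C]_(n, 2 ^ j) :=
  match j with
  | 0 => castmx (erefl n, esym (expn0 2)) v
  | j'.+1 => castmx (erefl n, expn2S_eq j')
      (row_mx (intertwiner B v j') (- (B j'.*2.+2 *m intertwiner B v j')))
  end.

Lemma mulmx_castr m p q q' (e : q = q') (T : 'M[C]_(m, p)) (A : 'M[C]_(p, q)) :
  T *m castmx (erefl p, e) A = castmx (erefl m, e) (T *m A).
Proof. by case: q' / e. Qed.

Lemma mulmx_cast_square m q q' (e : q = q') (A : 'M[C]_(m, q)) (D : 'M[C]_q) :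
  castmx (erefl m, e) A *m castmx (e, e) D = castmx (erefl m, e) (A *m D).
Proof. by case: q' / e. Qed.

(** [T] slides past the generators that build the columns until it reaches [v]. *)
Lemma intertwiner_eigen B v j (T : 'M[C]_n) a : T *m v = a *: v ->
  (forall l, (l < j)%N -> T *m B l.*2.+2 = B l.*2.+2 *m T) ->
  T *m intertwiner B v j = a *: intertwiner B v j.
Proof.
move=> Tv; elim: j => [|j IH] TB /=; first by rewrite mulmx_castr Tv castmxZ.
have {}IH : T *m intertwiner B v j = a *: intertwiner B v j by apply: IH => l /ltnW /TB.
rewrite mulmx_castr mul_mx_row mulmxN mulmxA TB // -mulmxA IH -castmxZ scale_row_mx.
by rewrite scalerN scalemxAr.
Qed.

(** The second hypothesis makes the kernel of [P] stable under the generators. *)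
Lemma intertwiner_orth p (P : 'M[C]_(p, n)) B v j : P *m v = 0 ->
  (forall i, (0 < i < j.*2.+2)%N -> exists E, P *m B i = E *m P) ->
  P *m intertwiner B v j = 0.
Proof.
move=> Pv; elim: j => [|j IH] PB /=; first by rewrite mulmx_castr Pv castmx_const.
have {}IH : P *m intertwiner B v j = 0.
  apply: IH => i /andP[i0 ij]; apply: PB; rewrite i0 doubleS /=; do 2 apply: ltnW.
  by rewrite !ltnS in ij *.
rewrite mulmx_castr mul_mx_row mulmxN mulmxA IH.
have [|E ->] := PB j.*2.+2; first by rewrite doubleS ltnS /= ltnW.
by rewrite -mulmxA IH mulmx0 oppr0 row_mx0 castmx_const.
Qed.

(** For a Clifford family these operators commute, and [v] plays the part of a highest weight vector
    of a spin representation. *)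
Definition highest B v j :=
  B 1%N *m v = 'i%C *: v /\ forall l, (l < j)%N -> pairp B l *m v = 'i%C *: v.

Lemma highestW B v j : highest B v j.+1 -> highest B v j.
Proof. by case=> h1 h2; split=> // l /ltnW /h2. Qed.

Lemma pairp_intertwiner B v j : clifford j.*2.+4 B -> highest B v j.+1 ->
  pairp B j *m intertwiner B v j = 'i%C *: intertwiner B v j.
Proof.
move=> cB [_ hv]; apply: intertwiner_eigen => [|l lj]; first exact: hv.
have l2 : (l.*2.+2 < j.*2.+2)%N by rewrite !ltnS ltn_double.
apply: (pairp_comm cB) => //.
- by rewrite (ltn_trans l2) // ltnS ltnW.
- by rewrite neq_ltn l2.
- by rewrite neq_ltn (ltn_trans l2).
Qed.

(** At each doubling the halves [W] and [c W] lie in the eigenspaces of the skew-Hermitian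
    [pairp B j] for i and -i, so they are orthogonal; [c] is unitary, so both are isometries. *)
Lemma intertwiner_isometry B v j : clifford j.*2.+2 B -> highest B v j ->
  mxH v *m v = 1%:M -> mxH (intertwiner B v j) *m intertwiner B v j = 1%:M.
Proof.
move=> + + v1; elim: j => [|j IH] cB hv /=.
  exact: castmx_isometry.
rewrite doubleS in cB.
have := pairp_intertwiner cB hv.
have {}IH := IH (cliffordW (ltnW (leqnSn _)) cB) (highestW hv).
set W := intertwiner B v j in IH *; set c := B _; set T := pairp B j => TW.
rewrite mxH_cast /= mxH_row.
case: _ / (expn2S_eq j).
rewrite mul_col_row IH mxHN mxHM (cliffordH cB) ?ltnS ?leqnSn //= -/c.
have WcW : mxH W *m (c *m W) = 0.
  have WT : mxH W *m T = 'i%C *: mxH W.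
    rewrite -[T]opprK -(pairpH cB) // mulmxN -mxHM TW mxHZ -scaleNr; congr (_ *: _).
    by complex_ring.
  (* Letting [T] act to the left gives the factor i, to the right -i; as 2i is nonzero, the product
     without [T] vanishes. *)
  have : mxH W *m (T *m (c *m W)) = mxH W *m (T *m (c *m W)) by [].
  rewrite {1}mulmxA WT -scalemxAl [T *m _]mulmxA (pairp_anticomm cB) // -/c -/T.
  rewrite mulNmx -mulmxA TW mulmxN -!scalemxAr -scaleNr => /eqP.
  rewrite -subr_eq0 -scalerBl scaler_eq0 => /orP[|/eqP//].
  by rewrite eq_complex /= => /andP[_]; rewrite opprK -(natrD _ 1 1) pnatr_eq0.
rewrite !mulmxN !(mulNmx, opprK, mulmxN) -!mulmxA WcW [c *m (c *m W)]mulmxA (clifford_sqr cB).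
  by rewrite mulNmx mul1mx mulmxN IH opprK oppr0 -scalar_mx_block.
by lia.
Qed.

(** Put W' = - c W, with c and d the two new generators. Then c W = - W', c W' = W, d W = i W' and d
    W' = i W, which are the off-diagonal blocks of [Hrec]. The older generators change sign across
    c, so on W' they act through the adjoint. *)
Lemma lin_intertwiner B v j x : clifford j.*2.+2 B -> highest B v j ->
  lin B j x *m intertwiner B v j = intertwiner B v j *m Hrec j x.
Proof.
elim: j x => [|j IH] x cB hv.
  rewrite lin0 /= mulmx_castr mulmx_cast_square; congr (castmx _ _).
  rewrite mulmxDl mul_scalar_mx -scalemxAl hv.1 scalerA -scalerDl mul_mx_scalar; congr (_ *: _).
  by complex_ring.
rewrite doubleS in cB.
have := pairp_intertwiner cB hv.
have {}IH x' := IH x' (cliffordW (ltnW (leqnSn _)) cB) (highestW hv).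
rewrite /pairp => cdW.
rewrite /= mulmx_castr mulmx_cast_square linS; congr (castmx _ _).
set W := intertwiner B v j in IH cdW *; set c := B j.*2.+2 in cdW *.
set d := B j.*2.+3 in cdW *.
have c2 : c *m c = - 1%:M by rewrite (clifford_sqr cB) // ltnS leqnSn.
have dW : d *m W = 'i%C *: - (c *m W).
  rewrite -[d]mul1mx -[1%:M]opprK -c2 !mulNmx -!mulmxA [c *m (d *m W)]mulmxA cdW.
  by rewrite -scalemxAr scalerN.
have cW' : c *m (- (c *m W)) = W by rewrite mulmxN mulmxA c2 mulNmx mul1mx opprK.
have dW' : d *m (- (c *m W)) = 'i%C *: W.
  have dc : d *m c = - (c *m d) by apply: (cliffordC cB); lia.
  by rewrite mulmxN mulmxA dc mulNmx opprK.
have lW' : lin B j x *m (- (c *m W)) = - (c *m W) *m mxH (Hrec j x).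
  rewrite -Hrec_conjx mulmxN mulmxA (lin_anticomm _ cB) ?leqnn ?leqnSn //.
  by rewrite -mulmxA IH mulNmx mulmxA.
move: (lin B j x) (IH x) lW' => L lW lW'.
rewrite mul_mx_row mul_row_block !mulmxDl lW' lW -!scalemxAl cW' dW' dW.
rewrite !mulmxN !mul_mx_scalar scalerN -addrA; congr (row_mx _ _).
  congr (_ + _); rewrite !(scalerN, opprK) scalerA -scalerBl; congr (_ *: _).
  by complex_ring.
rewrite -addrA [RHS]addrC; congr (_ + _).
rewrite scalerA -scalerDl; congr (_ *: _).
by complex_ring.
Qed.

(** Generic in [V] so as to act on generators and on indeterminates alike; at the last index
    [j.*2.+1] it passes from H to its minus variant. *)
Definition flip (V : zmodType) m (f : nat -> V) i := if i == m then - f i else f i.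

Lemma clifford_flip N m B : clifford N B -> clifford N (flip m B).
Proof.
move=> cB; split=> [i iN|i iN|i j iN jN ij]; rewrite /flip.
- by case: ifP => _; rewrite ?mxHN (cliffordH cB).
- by case: ifP => _; rewrite ?mulmxN ?mulNmx ?opprK (clifford_sqr cB).
- have := cliffordC cB iN jN ij.
  by do 2 case: ifP => _; rewrite ?mulmxN ?mulNmx ?opprK => ->; rewrite ?opprK.
Qed.

(** The two signs cancel, so a copy of H for the flipped family is a copy of the minus variant for
    [B]. *)
Lemma lin_flip B j m x : (0 < m)%N -> lin (flip m B) j (flip m x) = lin B j x.
Proof.
move=> m0; rewrite /lin /flip (ltn_eqF m0); congr (_ + _).
by apply: eq_bigr => i _; case: ifP => // _; rewrite scalerN rmorphN scaleNr opprK.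
Qed.

Lemma scale_ii (v : 'cV[C]_n) : 'i%C *: ('i%C *: v) = - v.
Proof. by rewrite scalerA -expr2 sqr_i scaleN1r. Qed.

(** * Common eigenvectors inside an invariant subspace [S] *)

Section HighestVector.
Variables (B : nat -> 'M[C]_n) (j : nat) (S : 'cV[C]_n -> Prop).
Hypothesis cB : clifford j.*2.+2 B.
Hypothesis SD : forall u v, S u -> S v -> S (u + v).
Hypothesis SZ : forall a v, S v -> S (a *: v).
Hypothesis SB : forall i v, (0 < i < j.*2.+2)%N -> S v -> S (B i *m v).

Lemma clifford_mul_neq0 i v : (0 < i < j.*2.+2)%N -> v != 0 -> B i *m v != 0.
Proof.
move=> iN; apply: contra => /eqP Bv0; rewrite -oppr_eq0 -[- v]mul1mx mulmxN -mulNmx.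
by rewrite -(clifford_sqr cB iN) -mulmxA Bv0 mulmx0.
Qed.

(* As T^2 = -1, the vector T v + i v lies in the i-eigenspace of T; when it
   vanishes v is a (-i)-eigenvector. *)
Lemma sqrN1_eigen (T : 'M[C]_n) v : T *m T = - 1%:M ->
  T *m (T *m v + 'i%C *: v) = 'i%C *: (T *m v + 'i%C *: v).
Proof.
by move=> T2; rewrite mulmxDr mulmxA T2 mulNmx mul1mx scalerDr scale_ii -scalemxAr addrC.
Qed.

(** Eigenvalues are adjusted one pair at a time. If [pairp B l] acts as -i on the current vector,
    [B l.*2.+2] moves that vector to the eigenvalue i, and it commutes with the earlier pairs. *)
Lemma pairp_eigenvector l v : (l <= j)%N -> S v -> v != 0 ->
  exists2 u, S u /\ u != 0 & forall l', (l' < l)%N -> pairp B l' *m u = 'i%C *: u.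
Proof.
move=> + Sv v0; elim: l => [|l IH] lj; first by exists v.
have [{Sv v0}v [Sv v0] Tv] := IH (ltnW lj).
have l3 : (l.*2.+3 < j.*2.+2)%N by lia.
have SC u : S u -> S (B l.*2.+2 *m u) by apply: SB; lia.
have ST : S (pairp B l *m v) by rewrite -mulmxA; apply: SC; apply: SB => //; lia.
have [w0|wN0] := eqVneq (pairp B l *m v + 'i%C *: v) 0; last first.
  exists (pairp B l *m v + 'i%C *: v); first by split=> //; apply: SD => //; apply: SZ.
  move=> l'; rewrite ltnS leq_eqVlt => /predU1P[->|l'l].
    by apply: sqrN1_eigen; apply: (pairp_sqr cB).
  rewrite mulmxDr -scalemxAr (Tv _ l'l) scalerDr; congr (_ + _).
  rewrite mulmxA (pairpC cB); [|lia..].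
  by rewrite -(mulmxA (pairp B l)) (Tv _ l'l) -scalemxAr.
exists (B l.*2.+2 *m v); first by split; [exact: SC | apply: clifford_mul_neq0 => //; lia].
move=> l'; rewrite ltnS leq_eqVlt => /predU1P[->|l'l].
  rewrite mulmxA (pairp_anticomm cB) // mulNmx -mulmxA.
  by move/eqP: w0; rewrite addr_eq0 => /eqP->; rewrite mulmxN opprK -scalemxAr.
by rewrite mulmxA (pairp_comm cB); try lia; rewrite -mulmxA Tv // -scalemxAr.
Qed.

(** Once all pairs have eigenvalue i, only [B 1] can have the wrong one, -i. Applying [B j.*2]
    repairs it but spoils the last pair, which negating the last generator sets right. *)
Lemma highest_exists v : S v -> v != 0 ->
  exists2 u, S u /\ u != 0 & highest B u j \/ highest (flip j.*2.+1 B) u j.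
Proof.
move=> Sv v0; have [{Sv v0}v [Sv v0] Tv] := pairp_eigenvector (leqnn j) Sv v0.
have [w0|wN0] := eqVneq (B 1%N *m v + 'i%C *: v) 0; last first.
  exists (B 1%N *m v + 'i%C *: v).
    by split=> //; apply: SD; [exact: SB | exact: SZ].
  left; split; first by apply: sqrN1_eigen; apply: (clifford_sqr cB).
  move=> l lj; rewrite mulmxDr -scalemxAr mulmxA (pairp_comm cB); try lia.
  by rewrite -mulmxA Tv // -scalemxAr scalerDr.
move/eqP: w0; rewrite addr_eq0 => /eqP B1v.
(* For [j = 0] the last generator is [B 1] itself, and flipping it is enough. *)
have [j0|j_gt0] := posnP j.
  exists v => //; right; split=> [|l]; last by rewrite j0.
  by rewrite /flip j0 /= mulNmx B1v opprK.
have [l lE] : exists l, j = l.+1 by exists j.-1; rewrite prednK.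
have fl i : (i < j.*2.+1)%N -> flip j.*2.+1 B i = B i.
  by move=> ij; rewrite /flip; case: eqP => // e; rewrite e ltnn in ij.
exists (B l.*2.+2 *m v).
  by split; [apply: SB => //; lia | apply: clifford_mul_neq0 => //; lia].
right; split=> [|l' l'j].
  rewrite fl; last by lia.
  by rewrite mulmxA (cliffordC cB); [rewrite mulNmx -mulmxA B1v mulmxN opprK -scalemxAr|lia..].
have [l'l|l'l] := eqVneq l' l; last first.
  rewrite /pairp !fl; try lia.
  rewrite mulmxA -/(pairp B l') (pairp_comm cB); try lia.
  by rewrite -mulmxA Tv // -scalemxAr.
rewrite l'l /pairp fl; last by lia.
rewrite /flip lE doubleS eqxx mulmxN mulNmx mulmxA -/(pairp B l) (pairp_anticomm cB); last by lia.
by rewrite mulNmx opprK -mulmxA Tv ?lE // -scalemxAr.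
Qed.

End HighestVector.

End Clifford.

(** * Splitting off copies of H and of its minus variant *)

Section Decomposition.
Variable R : rcfType.
Local Notation C := (R[i]).
Implicit Types x : nat -> R.

(** Since [m.+1 * q] reduces to [q + m * q], a block is prepended without a cast. *)
Lemma tens1S (F : pzRingType) m q (H : 'M[F]_q) :
  (1%:M : 'M_m.+1) *t H = block_mx H 0 0 ((1%:M : 'M_m) *t H) :> 'M_(q + m * q).
Proof.
rewrite (scalar_mx_block 1 m) tens_block_mx tens_scalar1mx tens0mx.
rewrite (_ : (0 : 'cV_m) *t H = 0) ?tens0mx //.
etransitivity; first exact: (castmx_block (mul1n q) (mul1n q) (erefl _) (erefl _)).
by rewrite castmx_comp !castmx_id !castmx_const.
Qed.

Definition Dmat j n1 n2 x : 'M[C]_(n1 * 2 ^ j + n2 * 2 ^ j) :=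
  block_mx ((1%:M : 'M_n1) *t Hrec j x) 0 0 ((1%:M : 'M_n2) *t Hrec j (flip j.*2.+1 x)).

Lemma isometry_leq m n (P : 'M[C]_(n, m)) : mxH P *m P = 1%:M -> (m <= n)%N.
Proof.
move=> PP; rewrite -{1}(mxrank1 C m) -PP (leq_trans (mxrankM_maxl _ _)) //.
exact: rank_leq_col.
Qed.

Lemma exists_orth m n (P : 'M[C]_(n, m)) : (m < n)%N ->
  exists2 v : 'cV[C]_n, v != 0 & mxH P *m v = 0.
Proof.
(* [kermx] is a kernel on row vectors, hence the transposes. *)
move=> mn; pose K := kermx (mxH P)^T.
have K0 : K != 0.
  rewrite kermx_eq0 -row_leq_rank -ltnNge (leq_ltn_trans _ mn) //.
  exact: rank_leq_col.
exists (nz_row K)^T; first by rewrite trmx_eq0 nz_row_eq0.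
apply: trmx_inj; rewrite trmx_mul trmxK trmx0.
by apply/sub_kermxP; apply: nz_row_sub.
Qed.

Section Family.
Variables (n j : nat) (B : nat -> 'M[C]_n).
Hypothesis cB : clifford j.*2.+2 B.

Lemma lin_unitx i : (0 < i < j.*2.+2)%N -> lin B j (unitx R i) = B i.
Proof.
move=> /andP[i0 ij]; rewrite /lin /unitx (ltn_eqF i0) raddf0 add0r.
rewrite (bigD1_seq i) ?iota_uniq ?mem_index_iota ?i0 //= eqxx scale1r big1 ?addr0 // => l li.
by rewrite (negbTE li) scale0r.
Qed.

(** The column span of [P] is invariant under skew-Hermitian generators, so its orthogonal
    complement is too; a normalised eigenvector found there generates the new copy. *)
Lemma intertwiner_exists m (P : 'M[C]_(n, m)) (D : (nat -> R) -> 'M[C]_m) : (m < n)%N ->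
  (forall x, lin B j x *m P = P *m D x) ->
  exists2 W : 'M[C]_(n, 2 ^ j), mxH W *m W = 1%:M /\ mxH P *m W = 0 &
    (forall x, lin B j x *m W = W *m Hrec j x) \/
    (forall x, lin B j x *m W = W *m Hrec j (flip j.*2.+1 x)).
Proof.
move=> mn linP.
(* At a unit vector [linP] concerns the single generator [B i]; its adjoint gives [E]. *)
have PB i : (0 < i < j.*2.+2)%N -> exists E, mxH P *m B i = E *m mxH P.
  move=> ij; exists (- mxH (D (unitx R i))).
  by rewrite mulNmx -mxHM -linP lin_unitx // mxHM (cliffordH cB) // mulmxN opprK.
have [v v0 Pv] := exists_orth P mn.
have [||i u ij Pu|u [Pu u0] hu] :=
  @highest_exists _ _ _ _ (fun v => mxH P *m v = 0) cB _ _ _ v Pv v0.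
- by move=> u w Pu Pw; rewrite mulmxDr Pu Pw addr0.
- by move=> a u Pu; rewrite -scalemxAr Pu scaler0.
- by have [E PE] := PB i ij; rewrite mulmxA PE -mulmxA Pu mulmx0.
have [r r0 uu] := mxH_mulmx_cV u0.
pose w := (r^-1)%:C%C *: u.
have ww : mxH w *m w = 1%:M.
  rewrite mxHZ conjc_real -scalemxAl -scalemxAr uu !scale_scalar_mx -!rmorphM /=.
  by rewrite (_ : r^-1 * (r^-1 * r ^+ 2) = 1) //; field.
have Pw : mxH P *m w = 0 by rewrite -scalemxAr Pu scaler0.
have hw B' : highest B' u j -> highest B' w j.
  case=> h1 h2; split=> [|l lj]; rewrite -scalemxAr ?h1 ?h2 // !scalerA mulrC //.
case: hu => /hw hu; [exists (intertwiner B w j)|exists (intertwiner (flip j.*2.+1 B) w j)].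
- split; first exact: intertwiner_isometry.
  exact: intertwiner_orth.
- by left=> x; apply: lin_intertwiner.
- split; first by apply: intertwiner_isometry => //; apply: clifford_flip.
  apply: intertwiner_orth => // i ij; rewrite /flip; have [E PE] := PB i ij.
  by case: ifP => _; [exists (- E); rewrite mulmxN PE mulNmx | exists E].
right=> x; rewrite -lin_intertwiner ?lin_flip //; exact: clifford_flip.
Qed.

Lemma row_isometry p q (P : 'M[C]_(n, p)) (Q : 'M[C]_(n, q)) :
  mxH P *m P = 1%:M -> mxH Q *m Q = 1%:M -> mxH P *m Q = 0 ->
  mxH (row_mx P Q) *m row_mx P Q = 1%:M.
Proof.
move=> PP QQ PQ; rewrite mxH_row mul_col_row PP QQ PQ.
have -> : mxH Q *m P = 0 by rewrite -[P]mxHK -mxHM PQ mxH0.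
by rewrite -scalar_mx_block.
Qed.

Definition intertwines n1 n2 (P : 'M[C]_(n, n1 * 2 ^ j + n2 * 2 ^ j)) :=
  mxH P *m P = 1%:M /\ forall x, lin B j x *m P = P *m Dmat j n1 n2 x.

(** The new copy goes to the front of the group of its type, where [tens1S] expects it. *)
Lemma intertwines_extend n1 n2 (P : 'M[C]_(n, n1 * 2 ^ j + n2 * 2 ^ j)) :
  (n1 * 2 ^ j + n2 * 2 ^ j < n)%N -> intertwines P ->
  (exists Q, @intertwines n1.+1 n2 Q) \/ (exists Q, @intertwines n1 n2.+1 Q).
Proof.
move=> lt_n [PP linP]; have [W [WW PW] linW] := intertwiner_exists lt_n linP.
move: PP PW linP; rewrite -[P]hsubmxK; set P1 := lsubmx P; set P2 := rsubmx P.
rewrite mxH_row mul_col_row mul_col_mx (scalar_mx_block (n1 * 2 ^ j)).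
move=> /eq_block_mx[P11 P12 _ P22] /eqP; rewrite col_mx_eq0 => /andP[/eqP P1W /eqP P2W] linP.
have WP p (Q : 'M_(n, p)) : mxH Q *m W = 0 -> mxH W *m Q = 0.
  by move=> QW; rewrite -[Q]mxHK -mxHM QW mxH0.
have {}linP x : lin B j x *m P1 = P1 *m (1%:M *t Hrec j x) /\
    lin B j x *m P2 = P2 *m (1%:M *t Hrec j (flip j.*2.+1 x)).
  have := linP x; rewrite mul_mx_row /Dmat mul_row_block !mulmx0 addr0 add0r.
  by move/eq_row_mx.
case: linW => linW; [left; exists (row_mx (row_mx W P1) P2)
                    |right; exists (row_mx P1 (row_mx W P2))].
- split.
    apply: row_isometry => //; first by apply: row_isometry => //; apply: WP.
    by rewrite mxH_row mul_col_mx P12 WP // col_mx0.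
  move=> x; have [l1 l2] := linP x.
  rewrite /Dmat tens1S mul_mx_row mul_row_block !mulmx0 addr0 add0r l2; congr (row_mx _ _).
  by rewrite mul_mx_row mul_row_block !mulmx0 addr0 add0r linW l1.
- split.
    apply: row_isometry => //; first by apply: row_isometry => //; apply: WP.
    by rewrite mul_mx_row P12 P1W row_mx0.
  move=> x; have [l1 l2] := linP x.
  rewrite /Dmat tens1S mul_mx_row mul_row_block !mulmx0 addr0 add0r l1; congr (row_mx _ _).
  by rewrite mul_mx_row mul_row_block !mulmx0 addr0 add0r linW l2.
Qed.

Lemma intertwines_exists :
  exists n1 n2, (n1 * 2 ^ j + n2 * 2 ^ j = n)%N /\ exists P, @intertwines n1 n2 P.
Proof.
(* Induction on a bound [d] for the dimension still uncovered; each extension lowers it by [2 ^ j],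
   which is positive. *)
have aux d n1 n2 (P : 'M[C]_(n, n1 * 2 ^ j + n2 * 2 ^ j)) : intertwines P ->
    (n - (n1 * 2 ^ j + n2 * 2 ^ j) <= d)%N ->
    exists n1 n2, (n1 * 2 ^ j + n2 * 2 ^ j = n)%N /\ exists P, @intertwines n1 n2 P.
  elim: d n1 n2 P => [|d IH] n1 n2 P hP le_d;
    have le_n := isometry_leq hP.1; have [lt_n|ge_n] := ltnP (n1 * 2 ^ j + n2 * 2 ^ j) n.
  - by lia.
  - by exists n1, n2; split; [lia | exists P].
  - have := expn_gt0 2 j; rewrite /= => j0.
    by have [[Q hQ]|[Q hQ]] := intertwines_extend lt_n hP; apply: (IH _ _ Q hQ); rewrite mulSn; lia.
  - by exists n1, n2; split; [lia | exists P].
(* The start is the empty family of copies, a matrix with no columns. *)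
apply: (aux n 0%N 0%N 0); last exact: leq_subr.
by split=> [|x]; [apply/matrixP=> -[] | apply/matrixP=> ? []].
Qed.

End Family.
End Decomposition.

(** * The volume element and its trace *)

Section Volume.
Variable R : rcfType.
Local Notation C := (R[i]).

(** The volume element of the Clifford algebra: the ordered product of the generators 1 to 2j +
    1. *)
Fixpoint vol n (F : nat -> 'M[C]_n) j : 'M[C]_n :=
  if j is j'.+1 then vol F j' *m pairp F j' else F 1%N.

Lemma eq_vol n (F G : nat -> 'M[C]_n) j :
  (forall i, (0 < i < j.*2.+2)%N -> F i = G i) -> vol F j = vol G j.
Proof.
elim: j => [|j IH] FG /=; first exact: FG.
by rewrite IH /pairp ?FG //; [lia..|move=> i ij; apply: FG; lia].
Qed.

Lemma vol_morph n m (F : nat -> 'M[C]_n) (G : nat -> 'M[C]_m) (P : 'M[C]_(n, m)) j :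
  (forall i, (0 < i < j.*2.+2)%N -> F i *m P = P *m G i) -> vol F j *m P = P *m vol G j.
Proof.
elim: j => [|j IH] FG /=; first exact: FG.
rewrite /pairp -!mulmxA FG; last by lia.
rewrite (mulmxA (F _)) FG; last by lia.
by rewrite !mulmxA IH // => i ij; apply: FG; lia.
Qed.

Lemma vol_cast n m (e : n = m) (F : nat -> 'M[C]_n) j :
  vol (fun i => castmx (e, e) (F i)) j = castmx (e, e) (vol F j).
Proof. by case: m / e. Qed.

Lemma tensmx11 m n : (1%:M : 'M[C]_m) *t (1%:M : 'M[C]_n) = 1%:M.
Proof.
apply/matrixP=> a b; case: (mxtens_indexP a) => a1 a2; case: (mxtens_indexP b) => b1 b2.
by rewrite tensmxE !mxE (can_eq (@mxtens_indexK m n)) xpair_eqE -natrM mulnb.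
Qed.

Lemma tensmxZr m n p q (a : C) (A : 'M[C]_(m, n)) (D : 'M[C]_(p, q)) :
  A *t (a *: D) = a *: (A *t D).
Proof. by apply/matrixP=> i l; rewrite !mxE mulrCA. Qed.

Lemma mxtrace_cast n m (e : n = m) (A : 'M[C]_n) : \tr (castmx (e, e) A) = \tr A.
Proof. by case: m / e. Qed.

Lemma vol_block n m (F : nat -> 'M[C]_n) (G : nat -> 'M[C]_m) j :
  vol (fun i => block_mx (F i) 0 0 (G i)) j = block_mx (vol F j) 0 0 (vol G j).
Proof.
by elim: j => //= j ->; rewrite /pairp !mulmx_block !(mulmx0, mul0mx, addr0, add0r).
Qed.

Lemma vol_tens n m (F : nat -> 'M[C]_n) j :
  vol (fun i => (1%:M : 'M_m) *t F i) j = 1%:M *t vol F j.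
Proof. by elim: j => //= j ->; rewrite /pairp !tensmx_mul !mulmx1. Qed.

(** The number of factors is odd. *)
Lemma volN n (F : nat -> 'M[C]_n) j : vol (fun i => - F i) j = - vol F j.
Proof. by elim: j => //= j ->; rewrite /pairp !(mulNmx, mulmxN, opprK). Qed.

(** The last generator occurs exactly once in the product. *)
Lemma vol_flip n (F : nat -> 'M[C]_n) j : vol (flip j.*2.+1 F) j = - vol F j.
Proof.
case: j => [|j] /=; first by rewrite /flip eqxx.
rewrite (@eq_vol _ _ F) => [|i ij]; last by rewrite /flip; case: eqP => //; lia.
by rewrite /pairp /flip doubleS eqxx ltn_eqF // mulmxN mulmxN.
Qed.

Lemma mxtrace_tens n m (A : 'M[C]_n) (D : 'M[C]_m) : \tr (A *t D) = \tr A * \tr D.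
Proof. by rewrite /mxtrace mulr_sum; apply: eq_bigr => i _; rewrite mxE. Qed.

Lemma Hrec_opp j (x y : nat -> R) : (forall i, y i = - x i) -> Hrec j y = - Hrec j x.
Proof.
move=> xy; rewrite (@eq_Hrec _ _ _ (fun i => -1 * x i + 0)) => [|i _].
  by rewrite (Hrec_linear j (-1) x (fun=> 0)) Hrec0 addr0 rmorphN scaleN1r.
by rewrite xy addr0 mulN1r.
Qed.

Lemma Hrec_flip_unitx j m i :
  Hrec j (flip m (unitx R i)) = flip m (fun i => Hrec j (unitx R i)) i.
Proof.
rewrite {2}/flip; case: eqP => [->|/eqP im].
  by apply: Hrec_opp => l; rewrite /flip /unitx; case: eqP; rewrite // oppr0.
apply: eq_Hrec => l _; rewrite /flip /unitx; case: eqP => // ->.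
by rewrite eq_sym (negbTE im) oppr0.
Qed.

Lemma HrecH_unitx j i : (0 < i)%N -> mxH (Hrec j (unitx R i)) = - Hrec j (unitx R i).
Proof.
move=> i0; rewrite -Hrec_conjx; apply: Hrec_opp => l; rewrite /conjx /unitx.
by case: (l =P 0%N) => // ->; rewrite ltn_eqF // oppr0.
Qed.

Lemma Hrec_unitx_ge j i : (j.*2.+2 <= i)%N -> Hrec j (unitx R i) = 0.
Proof.
move=> ji; rewrite -(Hrec0 R j); apply: eq_Hrec => l lj.
by rewrite /unitx ltn_eqF // (leq_trans lj).
Qed.

(** In the induction an old generator G becomes diag(G, -G), so the product of these oddly many is
    diag(z, -z) with z the previous value. The two new generators multiply to diag(i, -i), and the
    signs cancel. *)
Lemma vol_Hrec j : vol (fun i => Hrec j (unitx R i)) j = ('i%C ^+ j.+1)%:M.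
Proof.
elim: j => [|j IH]; first by rewrite /= castmx_scalar.
have hi i : (0 < i < j.*2.+2)%N -> Hrec j.+1 (unitx R i) =
    castmx (expn2S_eq j, expn2S_eq j)
      (block_mx (Hrec j (unitx R i)) 0 0 (- Hrec j (unitx R i))).
  move=> /andP[i0 ij]; rewrite /= HrecH_unitx //.
  have -> : unitx R i j.*2.+2 = 0 by rewrite /unitx gtn_eqF.
  have -> : unitx R i j.*2.+3 = 0 by rewrite /unitx gtn_eqF // (ltn_trans ij).
  by rewrite oppr0 raddf0 oppr0.
rewrite /= -/(Hrec j.+1) (eq_vol hi).
rewrite (vol_cast _ (fun i => block_mx (Hrec j (unitx R i)) 0 0 (- Hrec j (unitx R i)))).
rewrite vol_block volN IH /pairp !Hrec_unitx_ge //.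
have [u22 u33] : unitx R j.*2.+2 j.*2.+2 = 1 /\ unitx R j.*2.+3 j.*2.+3 = 1.
  by rewrite /unitx !eqxx.
have [u23 u32] : unitx R j.*2.+2 j.*2.+3 = 0 /\ unitx R j.*2.+3 j.*2.+2 = 0.
  by rewrite /unitx gtn_eqF // ltn_eqF.
rewrite u22 u23 u32 u33 mxH0 !castmx_mul2 !mulmx_block.
rewrite !(mulmx0, mul0mx, addr0, add0r) -!raddfN -!scalar_mxM.
rewrite -(castmx_scalar (expn2S_eq j)) (scalar_mx_block (2 ^ j)).
have e1 : (1%R +i* 0%R)%C * - ((-1) *i)%C = 'i%C :> C by complex_ring.
have e2 : - (1%R -i* 0%R)%C * 'i%C = - 'i%C :> C by complex_ring.
by congr (castmx _ (block_mx _%:M _ _ _%:M)); rewrite ?e1 ?e2 ?mulrNN -exprSr.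
Qed.

Lemma trace_vol_Dmat j n1 n2 :
  \tr (vol (fun i => Dmat j n1 n2 (unitx R i)) j)
    = (n1%:R - n2%:R) * ('i%C ^+ j.+1 *+ 2 ^ j).
Proof.
rewrite vol_block mxtrace_block.
rewrite (vol_tens _ (fun i => Hrec j (unitx R i))).
rewrite (vol_tens _ (fun i => Hrec j (flip j.*2.+1 (unitx R i)))).
rewrite (eq_vol (fun i _ => Hrec_flip_unitx j j.*2.+1 i)) vol_flip vol_Hrec.
by rewrite !mxtrace_tens !mxtrace1 raddfN /= mxtrace_scalar mulrN mulrBl.
Qed.

End Volume.

(** * Normalisation of a design, existence and uniqueness *)

Section Theorem2.
Variable R : rcfType.
Local Notation C := (R[i]).
Implicit Types x : nat -> R.

Lemma design_unitx p n m (A : 'I_m -> 'M[C]_(p, n)) (i : 'I_m) : design A (unitx R i) = A i.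
Proof.
rewrite /design (bigD1 i) //= /unitx eqxx scale1r big1 ?addr0 // => l li.
by rewrite val_eqE (negbTE li) scale0r.
Qed.

Lemma designD p n m (A : 'I_m -> 'M[C]_(p, n)) x y :
  design A (fun i => x i + y i) = design A x + design A y.
Proof.
by rewrite /design -big_split; apply: eq_bigr => i _; rewrite rmorphD scalerDl.
Qed.

Lemma sum_unitx_sqr m (i : 'I_m) : \sum_(l < m) unitx R i l ^+ 2 = 1.
Proof.
rewrite (bigD1 i) //= /unitx eqxx expr1n big1 ?addr0 // => l li.
by rewrite val_eqE (negbTE li) expr0n.
Qed.

Lemma HOD_isometry p n m (A : 'I_m -> 'M[C]_(p, n)) i :
  is_HOD A -> mxH (A i) *m A i = 1%:M.
Proof. by move=> /(_ (unitx R i)); rewrite design_unitx sum_unitx_sqr. Qed.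

(** Polarisation: at the sum of two unit vectors the diagonal terms already account for the value 1
    + 1, so the cross terms cancel. *)
Lemma HOD_anticomm p n m (A : 'I_m -> 'M[C]_(p, n)) i l : is_HOD A -> i != l ->
  mxH (A i) *m A l = - (mxH (A l) *m A i).
Proof.
move=> hA il; have := hA (fun k => unitx R i k + unitx R l k).
rewrite designD !design_unitx.
have -> : \sum_(k < m) (unitx R i k + unitx R l k) ^+ 2 = 1 + 1.
  rewrite -{1}(sum_unitx_sqr i) -(sum_unitx_sqr l) -big_split; apply: eq_bigr => k _ /=.
  rewrite sqrrD (_ : unitx R i k * unitx R l k = 0) ?mul0rn ?addr0 //.
  rewrite /unitx; case: eqP => [ki|]; last by rewrite mul0r.
  by rewrite ki val_eqE (negbTE il) mulr0.
rewrite mxHD mulmxDl !mulmxDr !HOD_isometry // rmorphD rmorph1 raddfD /= -!addrA.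
move/addrI/eqP; rewrite !addrA eq_sym -subr_eq subrr eq_sym addr_eq0 => /eqP.
by [].
Qed.

Section Normalise.
Variables (n j : nat) (A : 'I_(j.+1.*2) -> 'M[C]_n).
Hypothesis hA : is_HOD A.

(** Indexing by naturals matches [clifford]; [inord] is faithful only below [j.*2.+2], whence the
    range conditions below. *)
Let A_ i := A (inord i : 'I_(j.*2.+1.+1)).

Definition normalised i : 'M[C]_n := mxH (A_ 0) *m A_ i.

Let A_unitary i : A_ i *m mxH (A_ i) = 1%:M.
Proof. by apply: mulmx1C; apply: HOD_isometry. Qed.

(** Taking the adjoint of the left factor brings [A_ 0] next to its inverse, which reduces the
    Clifford relations to those of the design. *)
Lemma normalised_mul i l : normalised i = - mxH (normalised i) ->
  normalised i *m normalised l = - (mxH (A_ i) *m A_ l).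
Proof.
move=> ->; rewrite /normalised mxHM mxHK mulNmx -mulmxA (mulmxA (A_ 0)) A_unitary.
by rewrite mul1mx.
Qed.

Lemma A_anticomm i l : (i < j.*2.+2)%N -> (l < j.*2.+2)%N -> i != l ->
  mxH (A_ i) *m A_ l = - (mxH (A_ l) *m A_ i).
Proof.
by move=> ij lj il; apply: HOD_anticomm => //; rewrite -val_eqE /= !inordK.
Qed.

Lemma normalised_clifford : clifford j.*2.+2 normalised.
Proof.
have nH i : (0 < i < j.*2.+2)%N -> mxH (normalised i) = - normalised i.
  by move=> /andP[i0 ij]; rewrite /normalised mxHM mxHK A_anticomm // -lt0n.
have nH' i : (0 < i < j.*2.+2)%N -> normalised i = - mxH (normalised i).
  by move=> /nH->; rewrite opprK.
split=> // [i ij|i l ij lj il]; rewrite !normalised_mul; try exact: nH'.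
  by rewrite HOD_isometry.
by rewrite A_anticomm //; [case/andP: ij|case/andP: lj].
Qed.

Lemma design_normalised x : design A x = A_ 0 *m lin normalised j x.
Proof.
rewrite /lin mulmxDr mul_mx_scalar /design.
rewrite (big_ord_recl j.*2.+1) big_add1 /= big_mkord mulmx_sumr; congr (_ + _).
  by congr (_ *: A _); apply: val_inj; rewrite /= inordK.
apply: eq_bigr => i _; rewrite -scalemxAr /normalised mulmxA A_unitary mul1mx.
by congr (_ *: A _); apply: val_inj; rewrite /= inordK // ltnS.
Qed.

Lemma HOD_decomp_exists : exists n1 n2 : nat,
  (n1 * 2 ^ j + n2 * 2 ^ j = n)%N /\ HOD_decomp (k := j.+1) A n1 n2.
Proof.
have [n1 [n2 [e [P [PP linP]]]]] := intertwines_exists normalised_clifford.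
exists n1, n2; split=> //; exists e.
pose Q := castmx (erefl n, e) P.
have QQ : mxH Q *m Q = 1%:M by apply: castmx_isometry.
have QQ' := mulmx1C QQ.
have linQ x : lin normalised j x *m Q = Q *m castmx (e, e) (Dmat j n1 n2 x).
  by rewrite mulmx_castr linP mulmx_cast_square.
(* The design is [A_ 0] times [lin], and the square isometry [Q] conjugates [lin] into block
   form. *)
exists (A_ 0 *m Q), (mxH Q); split; last split.
- have A00 : mxH (A_ 0) *m A_ 0 = 1%:M by apply: HOD_isometry.
  have UU : mxH (A_ 0 *m Q) *m (A_ 0 *m Q) = 1%:M.
    by rewrite mxHM -mulmxA (mulmxA (mxH (A_ 0))) A00 mul1mx.
  by split=> //; apply: mulmx1C.
- by split; rewrite mxHK.
move=> x; have : design A x = A_ 0 *m Q *m castmx (e, e) (Dmat j n1 n2 x) *m mxH Q.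
  by rewrite -(mulmxA (A_ 0)) -linQ design_normalised -!mulmxA QQ' mulmx1.
by [].
Qed.

(** The block matrix is the identity at the first unit vector, so [A_ 0] is [U *m V] and each
    generator is a block matrix conjugated by [V]; the trace does not see the conjugation. *)
Lemma trace_vol_normalised n1 n2 : HOD_decomp (k := j.+1) A n1 n2 ->
  \tr (vol normalised j) = (n1%:R - n2%:R) * ('i%C ^+ j.+1 *+ 2 ^ j).
Proof.
case=> e [U [V [[UU _] [[VV VV'] dA]]]].
pose D i := castmx (e, e) (Dmat j n1 n2 (unitx R i)).
have AE i : (i < j.*2.+2)%N -> A_ i = U *m D i *m V.
  by move=> ij; rewrite -[A_ i]design_unitx /= inordK // dA.
have D0 : D 0%N = 1%:M.
  rewrite /D /Dmat (@eq_Hrec _ _ (flip _ _) (unitx R 0)) ?Hrec_unitx0 => [|i _].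
    by rewrite !tensmx11 -scalar_mx_block castmx_scalar.
  by rewrite /flip /unitx; case: eqP => // ->; rewrite oppr0.
have BV i : (0 < i < j.*2.+2)%N -> normalised i *m mxH V = mxH V *m D i.
  move=> /andP[_ ij]; rewrite /normalised !AE // D0 mulmx1 mxHM -!mulmxA VV' mulmx1.
  by rewrite (mulmxA (mxH U)) UU mul1mx.
have -> : vol normalised j = mxH V *m vol D j *m V.
  by rewrite -(vol_morph BV) -mulmxA VV mulmx1.
rewrite mxtrace_mulC mulmxA VV' mul1mx.
by rewrite (vol_cast e (fun i => Dmat j n1 n2 (unitx R i))) mxtrace_cast trace_vol_Dmat.
Qed.

Lemma HOD_decomp_unique n1 n2 m1 m2 : (n1 + n2 = m1 + m2)%N ->
  HOD_decomp (k := j.+1) A n1 n2 -> HOD_decomp (k := j.+1) A m1 m2 ->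
  m1 = n1 /\ m2 = n2.
Proof.
(* Both decompositions compute one trace; cancelling its nonzero factor equates the differences, and
   the sums agree by [nm]. *)
move=> nm /trace_vol_normalised + /trace_vol_normalised => -> /mulIf.
have i0 : 'i%C != 0 :> C by rewrite eq_complex /= oner_eq0 andbF.
rewrite -mulr_natr mulf_neq0 ?expf_neq0 ?pnatr_eq0 -?lt0n ?expn_gt0 // => /(_ isT)/eqP.
by rewrite subr_eq addrAC eq_sym subr_eq -!natrD eqr_nat => /eqP; lia.
Qed.

End Normalise.

Lemma HOD_exists n j : (2 ^ j %| n)%N ->
  exists A : 'I_(j.+1.*2) -> 'M[C]_n, is_HOD A.
Proof.
(* The witness is the direct sum of [m] copies of [Hrec j], given by its coefficients. *)
move=> /dvdnP[m ->]; exists (fun i : 'I_(j.+1.*2) => (1%:M : 'M_m) *t Hrec j (unitx R i)).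
move=> x; have -> : design (fun i : 'I_(j.+1.*2) => (1%:M : 'M_m) *t Hrec j (unitx R i)) x
    = 1%:M *t Hrec j x.
  rewrite Hrec_sum /design; apply/matrixP=> a b; rewrite mxE !summxE mulr_sumr.
  by apply: eq_bigr => i _; rewrite !mxE mulrCA.
rewrite mxH_tens tensmx_mul mxH1 mulmx1 Hrec_HOD.
by rewrite -[X in _ *t X%:M]mulr1 -scale_scalar_mx tensmxZr tensmx11 scale_scalar_mx mulr1.
Qed.

End Theorem2.

Theorem theorem2 (R : realType) (n k : nat) (hn : (0 < n)%N) (hk : (0 < k)%N) :
  ((exists A : 'I_(k.*2) -> 'M[R[i]]_n, is_HOD A) <-> (2 ^ k.-1 %| n)%N) /\
  (forall A : 'I_(k.*2) -> 'M[R[i]]_n, is_HOD A ->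
     exists n1 n2 : nat,
       (n1 + n2 = n %/ 2 ^ k.-1)%N /\ HOD_decomp A n1 n2 /\
       (forall m1 m2 : nat, (m1 + m2 = n %/ 2 ^ k.-1)%N -> HOD_decomp A m1 m2 ->
          m1 = n1 /\ m2 = n2)).
Proof.
case: k hk => // j _ /=; split.
  split=> [[A hA]|]; last exact: HOD_exists.
  by have [n1 [n2 [en _]]] := HOD_decomp_exists hA; rewrite -en -mulnDl dvdn_mull.
move=> A hA; have [n1 [n2 [en hD]]] := HOD_decomp_exists hA.
have en' : (n1 + n2 = n %/ 2 ^ j)%N by rewrite -en -mulnDl mulnK // expn_gt0.
exists n1, n2; split=> //; split=> // m1 m2 em.
by apply: HOD_decomp_unique => //; rewrite en' em.
Qed.
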